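(* Let $P$ be a finite set, let $\asymp$ be an equivalence relation on $P$. For $p \in P$, let $[p]^{\asymp}=\{x\in P: p\asymp x\}$. Then the following conditions are equivalent: (i) There exists a finite atomistic lattice $L$ such that $\langle P,\asymp\rangle\cong\langle \mathrm{J}(L),\asymp_L\rangle$. (ii) There exists a finite lattice $L$ such that $\langle P,\asymp\rangle\cong\langle \mathrm{J}(L),\asymp_L\rangle$. (iii) There exists $p\in P$ such that $|[p]^{\asymp}|\neq 2$.
   Context: For a finite lattice $L$, $\mathrm{J}(L)$ is the set of all join-irreducible elements of $L$ (the elements that cover exactly one element); for $q\in \mathrm{J}(L)$, $q_*$ denotes the unique element of $L$ covered by $q$. The join-dependency relation $D_L$ is the binary relation on $\mathrm{J}(L)$ defined by: $p\mathrel{D_L}q$ if and only if $p\neq q$ and there exists $x\in L$ such that $p\leq q\vee x$ and $p\nleq q_*\vee x$. The relation $\trianglelefteq_L$ is the reflexive and transitive closure of $D_L$ on $\mathrm{J}(L)$. The equivalence relation $\asymp_L$ on $\mathrm{J}(L)$ is defined by: $p\asymp_L q$ if and only if $p\trianglelefteq_L q$ and $q\trianglelefteq_L p$. A finite lattice is atomistic if every element is a (finite) supremum of atoms. An isomorphism $\langle P,\asymp\rangle\cong\langle \mathrm{J}(L),\asymp_L\rangle$ is a bijection preserving and reflecting the relations.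
   Formalization: The set P is assumed nonempty; for empty P the one-element lattice satisfies (i) and (ii), while (iii) fails since there is no p in P. *)

(* Defs.v *)
From HB Require Import structures.
From mathcomp Require Import all_boot all_order.
Set Implicit Arguments.
Unset Strict Implicit.
Unset Printing Implicit Defensive.
Import Order.TTheory.
Local Open Scope order_scope.

(* A finite lattice is a [finTBLatticeType], that is, a nonempty finite
   lattice; the one-element lattice is included. *)
Section FiniteLattice.
Context {d : Order.disp_t} {L : finTBLatticeType d}.
Implicit Types (x y z q : L).

(* [covered_by x y]: y covers x. *)
Definition covered_by x y : bool :=
  (x < y) && [forall z, ~~ ((x < z) && (z < y))].

Definition join_irreducible q : bool := #|[set x | covered_by x q]| == 1%N.

(* q_*; the default \bot is irrelevant when q is join-irreducible. *)
Definition lower_cover q : L := odflt \bot [pick x | covered_by x q].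

Definition atom x : bool := covered_by \bot x.

End FiniteLattice.

(* The empty join is \bot, so \bot needs no special treatment. *)
Definition atomistic (d : Order.disp_t) (L : finTBLatticeType d) : Prop :=
  forall x : L, exists2 A : {set L},
    (forall a, a \in A -> atom a) & x = \join_(a in A) a.

Definition J (d : Order.disp_t) (L : finTBLatticeType d) : finType :=
  {q : L | join_irreducible q}.

Section JoinDependency.
Context {d : Order.disp_t} {L : finTBLatticeType d}.
Implicit Types p q : J L.

Definition join_dep : rel (J L) := fun p q =>
  (p != q) &&
  [exists x : L, (sval p <= sval q `|` x)
                 && ~~ (sval p <= lower_cover (sval q) `|` x)].

(* [connect] is the reflexive and transitive closure. *)
Definition join_dep_le : rel (J L) := connect join_dep.

Definition join_dep_equiv : rel (J L) := fun p q =>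
  join_dep_le p q && join_dep_le q p.

End JoinDependency.

Definition rel_iso (S T : Type) (r : rel S) (s : rel T) : Prop :=
  exists2 f : S -> T, bijective f & forall x y, r x y = s (f x) (f y).

(* Main.v *)
Require Import Defs.
From mathcomp Require Import all_boot all_order.
From HB Require Import structures.

(** The implication from atomistic lattices to arbitrary ones is trivial.

    A finite lattice violates the condition that some class has size other
    than two only if it has no join-irreducible element.  The key fact
    ([join_dep_other]) is that whenever p D q there is some r <> q with p D r:
    a nontrivial join cover of p cannot be refined to the single element q.
    Choose p with as few elements reachable from it as possible; then every r
    with p D r is equivalent to p.  If the class of p were {p, q}, a path from
    p to q would start with p D q, and the element r given by the key fact
    would be a third member of the class.

    Conversely, let B0 be a class of size other than two.  Call a subset A of P
    closed if for all distinct x, y in A with x in B0, the class of y is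
    contained in A ([class_closed]).  The empty set and the singletons are
    closed, so the closed sets form an atomistic lattice whose join-irreducible
    elements are the singletons.  If p and q are distinct and equivalent, then
    B0 contains an element r other than p and q (this is where the size of B0
    matters), and p lies in the closure of {q, r}, so that p D q.  On the other
    hand, adding to a closed set a whole class other than B0 yields a closed
    set; hence p D q forces q to lie in the class of p or in B0.  This property
    is inherited by the reflexive and transitive closure of D, so that elements
    which are mutually reachable are equivalent. *)

(** * Join-irreducible elements and join-dependency in a finite lattice *)

Section FiniteLattice.

Set Implicit Arguments.
Unset Strict Implicit.

Import Order.TTheory.
Local Open Scope order_scope.

Context {d : Order.disp_t} {L : finTBLatticeType d}.
Implicit Types x y z l : L.

Lemma card_downset x y : x < y -> #|[set t | t <= x]| < #|[set t | t <= y]|.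
Proof.
move=> lt_xy; apply/proper_card/properP; split.
  by apply/subsetP=> u; rewrite !inE => /le_trans; apply; exact: ltW.
by exists y; rewrite inE ?lexx // lt_geF.
Qed.

Lemma exists_minimal (Q : pred L) x0 : Q x0 ->
  exists2 x, Q x & forall y, y < x -> ~~ Q y.
Proof.
move=> Qx0; case: (arg_minnP (fun x => #|[set t | t <= x]|) Qx0) => x Qx x_min.
exists x => // y /card_downset; rewrite ltEnat /= ltnNge.
by apply: contraNN => /x_min.
Qed.

Lemma exists_maximal (Q : pred L) x0 : Q x0 ->
  exists2 x, Q x & forall y, x < y -> ~~ Q y.
Proof.
move=> Qx0; case: (arg_maxnP (fun x => #|[set t | t <= x]|) Qx0) => x Qx x_max.
exists x => // y /card_downset; rewrite ltEnat /= ltnNge.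
by apply: contraNN => /x_max.
Qed.

Lemma lt_exists_cover x z : x < z -> exists2 y, x <= y & covered_by y z.
Proof.
move=> lt_xz.
have [|y /andP[le_xy lt_yz] y_max] :=
  @exists_maximal (fun y => (x <= y) && (y < z)) x; first by rewrite lexx.
exists y => //; rewrite /covered_by lt_yz; apply/forallP=> t.
apply/negP=> /andP[lt_yt lt_tz].
by have := y_max t lt_yt; rewrite lt_tz (le_trans le_xy (ltW lt_yt)).
Qed.

Lemma lower_coverP q : join_irreducible q ->
  covered_by (lower_cover q) q /\ forall z, z < q -> z <= lower_cover q.
Proof.
move=> /cards1P[c c_def].
have cE z : covered_by z q = (z == c) by rewrite -in_set1 -c_def inE.
have -> : lower_cover q = c.
  rewrite /lower_cover; case: pickP => [z|/(_ c)]; rewrite cE.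
    by move/eqP.
  by rewrite eqxx.
by split=> [|z /lt_exists_cover[y le_zy]]; rewrite cE // => /eqP <-.
Qed.

(** If the elements strictly below [q] are exactly those below some [l], then
    [q] is join-irreducible with lower cover [l]. *)
Lemma join_irreducible_lower q l : l < q -> (forall z, z < q -> z <= l) ->
  join_irreducible q /\ lower_cover q = l.
Proof.
move=> lt_lq l_max.
have jq : join_irreducible q.
  apply/cards1P; exists l; apply/setP=> z; rewrite !inE /covered_by.
  apply/andP/eqP=> [[lt_zq /forallP/(_ l)]|->].
    rewrite lt_lq andbT; have := l_max z lt_zq.
    by rewrite le_eqVlt => /orP[/eqP|->].
  split=> //; apply/forallP=> t; apply/negP=> /andP[lt_lt /l_max].
  by rewrite (lt_geF lt_lt).
split=> //; have [/andP[lt_cq _] c_max] := lower_coverP jq.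
by apply/le_anti; rewrite l_max // c_max.
Qed.

(** The witness [r] is a minimal element among those below [x] but not below
    [y]. *)
Lemma exists_join_irreducible x y : ~~ (x <= y) -> exists r : J L,
  [/\ sval r <= x, ~~ (sval r <= y) & lower_cover (sval r) <= y].
Proof.
move=> nle_xy.
have [|r /andP[le_rx nle_ry] r_min] :=
  @exists_minimal (fun r => (r <= x) && ~~ (r <= y)) x; first by rewrite lexx.
have below z : z < r -> z <= y.
  move=> lt_zr; have := r_min z lt_zr.
  by rewrite (le_trans (ltW lt_zr) le_rx) negbK.
have [||jr rE] := @join_irreducible_lower r (r `&` y).
- by rewrite lt_neqAle leIl andbT -leEmeet.
- by move=> z lt_zr; rewrite lexI ltW //= below.
by exists (exist _ r jr); rewrite /= rE leIr.
Qed.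

(** No element is join-dependent on a single element only: a nontrivial join
    cover of [p] cannot be refined to a single join-irreducible element. *)
Lemma join_dep_other (p q : J L) : join_dep p q ->
  exists2 r, r != q & join_dep p r.
Proof.
case/andP=> neq_pq /existsP[x0 /andP[le_p nle_p]].
have [_ q_max] := lower_coverP (valP q).
have nle_pq : ~~ (sval p <= sval q).
  apply: contraNN nle_p => le_pq.
  apply: (@le_trans _ _ (lower_cover (sval q))); last exact: leUl.
  by apply: q_max; rewrite lt_neqAle le_pq andbT.
(* That p is not below the join of q_* and x0 persists when x0 shrinks, so x0
   may be replaced by a minimal x such that p is below the join of q and x. *)
have [|x /andP[le_xx0 le_pqx] x_min] := @exists_minimal
    (fun x => (x <= x0) && (sval p <= sval q `|` x)) x0.
  by rewrite lexx.
have nle_px : ~~ (sval p <= x).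
  apply: contraNN nle_p => le_px; apply: le_trans (le_trans le_px le_xx0) _.
  exact: leUr.
have nle_qx : ~~ (sval q <= x).
  by apply: contraNN nle_px => /join_idPr le_qx; rewrite -le_qx.
have [|y _ /andP[lt_yx /forallP y_max]] := @lt_exists_cover \bot x.
  rewrite lt0x; apply: contraNN nle_pq => /eqP x_bot.
  by move: le_pqx; rewrite x_bot joinx0.
have nle_pqy : ~~ (sval p <= sval q `|` y).
  by have := x_min y lt_yx; rewrite (le_trans (ltW lt_yx) le_xx0).
(* As y is covered by x, the join of r and y is x; hence the join of q and y
   shows that p D r. *)
have [|r [le_rx nle_ry le_ry]] := @exists_join_irreducible x y.
  by rewrite lt_geF.
have rUy : sval r `|` y = x.
  have lt_yr : y < sval r `|` y.
    rewrite lt_neqAle leUr andbT; apply: contraNneq nle_ry => ->.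
    exact: leUl.
  have := y_max (sval r `|` y); rewrite lt_yr /= lt_neqAle leUx le_rx.
  by rewrite (ltW lt_yx) /= andbT negbK => /eqP.
exists r; first by apply: contraNneq nle_qx => <-.
apply/andP; split; first by apply: contraNneq nle_px => ->.
apply/existsP; exists (sval q `|` y); rewrite joinCA rUy le_pqx /=.
by rewrite joinCA (join_idPr le_ry).
Qed.

End FiniteLattice.

Section ClassSizes.

Set Implicit Arguments.
Unset Strict Implicit.

Context {d : Order.disp_t} {L : finTBLatticeType d}.

Lemma join_dep_equiv_class_neq2 (p0 : J L) :
  exists p : J L, #|[set q | join_dep_equiv p q]| <> 2.
Proof.
(* As the number of elements reachable from p is minimal, each r with p D r
   reaches p back. *)
case: (@arg_minnP _ p0 predT (fun p => #|join_dep_le p|) isT) => p _ p_min.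
have equiv r : join_dep p r -> join_dep_equiv p r.
  move=> Dpr; rewrite /join_dep_equiv {1}/join_dep_le connect1 //=.
  have sub : join_dep_le r \subset join_dep_le p.
    by apply/subsetP=> t; apply: connect_trans; exact: connect1.
  have [le_card] := subset_leqif_card sub.
  rewrite eqn_leq le_card p_min // => /esym/subsetP/(_ p); apply.
  exact: connect0.
(* If the class of p were {p, q}, then q would be the only r with p D r. *)
exists p => /eqP/cards2P[a [b [neq_ab ab_def]]].
have [q neq_qp q_def] :
    exists2 q, q != p & [set q | join_dep_equiv p q] = [set p; q].
  have : p \in [set q | join_dep_equiv p q].
    by rewrite inE /join_dep_equiv /join_dep_le !connect0.
  rewrite ab_def !inE => /orP[]/eqP ->; last by exists a; rewrite // setUC.
  by exists b; rewrite // eq_sym.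
have qE r : join_dep p r -> r = q.
  move=> Dpr; have : r \in [set p; q] by rewrite -q_def inE equiv.
  by rewrite !inE; case/andP: Dpr => /negPf; rewrite eq_sym => -> _ /eqP.
have Dpq : join_dep p q.
  have : q \in [set q | join_dep_equiv p q] by rewrite q_def !inE eqxx orbT.
  rewrite inE => /andP[/connectP[[|r s] /=]].
    by move=> _ qp; rewrite qp eqxx in neq_qp.
  by case/andP=> Dpr _ _; rewrite -(qE r).
have [r neq_rq /qE rq] := join_dep_other Dpq.
by rewrite rq eqxx in neq_rq.
Qed.

End ClassSizes.

(** * The lattice of closed sets of a closure system *)

(** A closure system on a finite set in which the empty set and the singletons
    are closed, given by the predicate that singles out the closed sets. *)
Record closure_system (T : finType) := ClosureSystem {
  closed : pred {set T};
  closedT : closed setT;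
  closedI : forall A B, closed A -> closed B -> closed (A :&: B);
  closed0 : closed set0;
  closed1 : forall x, closed [set x]
}.

Section ClosedSets.

Import Order.TTheory.

Set Implicit Arguments.
Unset Strict Implicit.

Variables (T : finType) (K : closure_system T).
Implicit Types (p q : T) (A B : {set T}).

(** The closed sets, to be ordered by inclusion. *)
Definition closed_set : predArgType := {A : {set T} | closed K A}.

HB.instance Definition _ := Finite.on closed_set.

Implicit Types X Y Z : closed_set.

(** The least closed set containing [A]. *)
Definition closure A : {set T} :=
  \bigcap_(B : {set T} | closed K B && (A \subset B)) B.

Lemma closure_closed A : closed K (closure A).
Proof.
apply: (big_ind (closed K)) => [||B /andP[]//]; first exact: closedT.
exact: closedI.
Qed.

Lemma closure_sub A B : closed K B -> (closure A \subset B) = (A \subset B).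
Proof.
move=> clB; apply/idP/idP=> [|sAB].
  by apply: subset_trans; apply/bigcapsP=> C /andP[].
by apply: bigcap_inf; rewrite clB.
Qed.

Definition closed_le X Y := val X \subset val Y.

Lemma closed_le_refl : reflexive closed_le.
Proof. by move=> X; exact: subxx. Qed.

Lemma closed_le_anti : antisymmetric closed_le.
Proof. by move=> X Y sXY; apply/val_inj/eqP; rewrite eqEsubset. Qed.

Lemma closed_le_trans : transitive closed_le.
Proof. by move=> Y X Z; exact: subset_trans. Qed.

HB.instance Definition _ := Order.Le_isPOrder.Build
  Order.SetSubsetOrder.subset_display closed_set
  closed_le_refl closed_le_anti closed_le_trans.

Definition closed_meet X Y : closed_set :=
  exist _ (val X :&: val Y) (closedI (valP X) (valP Y)).

Definition closed_join X Y : closed_set :=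
  exist _ (closure (val X :|: val Y)) (closure_closed (val X :|: val Y)).

Lemma closed_meetP X Y Z :
  closed_le X (closed_meet Y Z) = closed_le X Y && closed_le X Z.
Proof. exact: subsetI. Qed.

Lemma closed_joinP X Y Z :
  closed_le (closed_join X Y) Z = closed_le X Z && closed_le Y Z.
Proof. by rewrite /closed_le closure_sub ?subUset //; exact: valP. Qed.

HB.instance Definition _ := Order.POrder_MeetJoin_isLattice.Build
  _ closed_set closed_meetP closed_joinP.

Lemma closed_le0 X : closed_le (exist _ set0 (closed0 K)) X.
Proof. exact: sub0set. Qed.

Lemma closed_leT X : closed_le X (exist _ setT (closedT K)).
Proof. exact: subsetT. Qed.

HB.instance Definition _ := Order.hasBottom.Build _ closed_set closed_le0.
HB.instance Definition _ := Order.hasTop.Build _ closed_set closed_leT.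

Lemma closed_leE X Y : (X <= Y)%O = (val X \subset val Y).
Proof. by []. Qed.

(** The atom of the lattice of closed sets given by a point. *)
Definition point p : closed_set := exist _ [set p] (closed1 K p).

Lemma point_le p X : (point p <= X)%O = (p \in val X).
Proof. by rewrite closed_leE sub1set. Qed.

Lemma closed_leP X Y :
  reflect (forall p, (point p <= X)%O -> (point p <= Y)%O) (X <= Y)%O.
Proof.
apply: (iffP idP) => [le_XY p le_pX|le_XY]; first exact: le_trans le_XY.
by rewrite closed_leE; apply/subsetP=> p; rewrite -!point_le; exact: le_XY.
Qed.

Lemma point_join_irreducible p :
  join_irreducible (point p) /\ lower_cover (point p) = \bot%O.
Proof.
apply: join_irreducible_lower => [|X].
  by rewrite lt0x; apply/eqP=> /(congr1 val)/setP/(_ p); rewrite !inE eqxx.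
rewrite lt_neqAle closed_leE subset1 => /andP[neq_Xp /orP[]/eqP X_E].
  by case/eqP: neq_Xp; exact: val_inj.
by rewrite closed_leE X_E sub0set.
Qed.

Lemma point_atom p : atom (point p).
Proof.
have [jp pE] := point_join_irreducible p.
by have [] := lower_coverP jp; rewrite pE.
Qed.

(** A point as a join-irreducible element of the lattice of closed sets. *)
Definition point_J p : J closed_set :=
  exist _ (point p) (point_join_irreducible p).1.

Lemma point_J_bij : bijective point_J.
Proof.
have inj : injective point_J.
  by move=> p q [] /set1_inj.
apply: inj_card_bij => //.
suff /subset_leq_card : J closed_set \subset codom point_J.
  by rewrite card_codom.
apply/subsetP=> -[X jX] _; apply/codomP.
have [/andP[lt_lX _] l_max] := lower_coverP jX.
have /subsetPn[p Xp Nlp] : ~~ (val X \subset val (lower_cover X)).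
  by rewrite -closed_leE lt_geF.
exists p; apply: val_inj; apply/eqP; rewrite /= eq_sym.
have : (point p <= X)%O by rewrite point_le.
rewrite le_eqVlt => /orP[//|/l_max]; rewrite point_le => lp.
by rewrite lp in Nlp.
Qed.

Lemma closed_set_atomistic : atomistic closed_set.
Proof.
move=> X; exists [set point p | p in val X].
  by move=> _ /imsetP[p _ ->]; exact: point_atom.
apply/le_anti/andP; split; last first.
  by apply/joinsP=> _ /imsetP[p Xp ->]; rewrite point_le.
apply/closed_leP=> p le_pX; apply: (joins_min (j := point p)) => //.
by rewrite imset_f // -point_le.
Qed.

(** In terms of points, p D q means that q can be added to some closed set not
    containing p so that p enters the closure. *)
Lemma point_join_depP p q :
  reflect
    (p != q /\
     exists A, [/\ closed K A, p \notin A & p \in closure (q |: A)])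
    (join_dep (point_J p) (point_J q)).
Proof.
rewrite /join_dep (bij_eq point_J_bij).
apply: (iffP andP) => -[neq_pq].
  move=> /existsP[X]; rewrite (point_join_irreducible q).2 join0x !point_le.
  by case/andP=> pqX Xp; split=> //; exists (val X); split=> //; exact: valP.
case=> A [clA Ap pqA]; split=> //; apply/existsP; exists (exist _ A clA).
by rewrite (point_join_irreducible q).2 join0x !point_le Ap andbT.
Qed.

End ClosedSets.

(** * The closure system associated with a class *)

Section ClassLattice.

Set Implicit Arguments.
Unset Strict Implicit.

Variables (P : finType) (e : rel P) (e_equiv : equivalence_rel e) (p0 : P).

Implicit Types (p q x y z : P) (A B : {set P}).

Let e_refl : reflexive e.
Proof. by move=> x; case: (e_equiv x x x). Qed.

Let e_left : left_transitive e.
Proof. by case/equivalence_relP: e_equiv. Qed.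

Let e_sym : symmetric e.
Proof. by move=> x y; apply/idP/idP=> /e_left <-; rewrite e_refl. Qed.

(** Two distinct points of a closed set, the first of which is equivalent to
    [p0], force the class of the second to be contained in the set. *)
Definition class_closed (A : {set P}) : bool :=
  [forall x in A, forall y in A, (e p0 x && (x != y)) ==>
    ([set z | e y z] \subset A)].

Lemma class_closedP A :
  reflect
    (forall x y z, x \in A -> y \in A -> e p0 x -> x != y -> e y z -> z \in A)
    (class_closed A).
Proof.
apply: (iffP forall_inP) => [clA x y z Ax Ay p0x neq_xy yz|clA x Ax].
  have /forall_inP/(_ y Ay) := clA x Ax; rewrite p0x neq_xy => /subsetP; apply.
  by rewrite inE.
apply/forall_inP=> y Ay; apply/implyP=> /andP[p0x neq_xy].
by apply/subsetP=> z; rewrite inE; exact: clA neq_xy.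
Qed.

Lemma class_closedT : class_closed setT.
Proof. by apply/class_closedP=> *; rewrite inE. Qed.

Lemma class_closedI A B :
  class_closed A -> class_closed B -> class_closed (A :&: B).
Proof.
move=> /class_closedP clA /class_closedP clB; apply/class_closedP=> x y z.
rewrite !inE => /andP[Ax Bx] /andP[Ay By] p0x neq_xy yz.
by rewrite (clA x y) // (clB x y).
Qed.

Lemma class_closed0 : class_closed set0.
Proof. by apply/class_closedP=> x y z; rewrite inE. Qed.

Lemma class_closed1 p : class_closed [set p].
Proof.
by apply/class_closedP=> x y z /set1P-> /set1P-> _; rewrite eqxx.
Qed.

(** The closure system for the class of [p0]. *)
Definition class_system : closure_system P :=
  ClosureSystem class_closedT class_closedI class_closed0 class_closed1.

(** The class of [p0] must be excluded: a point of it added to [A] would also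
    force the classes of the points of [A] into the closure. *)
Lemma class_closedU A q :
  class_closed A -> ~~ e p0 q -> class_closed (A :|: [set z | e q z]).
Proof.
move=> /class_closedP clA Np0q; apply/class_closedP=> x y z.
rewrite !inE => /orP[Ax|qx] Ay p0x neq_xy yz; last first.
  by case/negP: Np0q; rewrite (e_left p0x) e_sym.
case/orP: Ay => [Ay|qy]; first by rewrite (clA x y).
by rewrite (e_left qy) yz orbT.
Qed.

(** If the right-hand side fails, adding the class of [q] to a closed set that
    omits [p] yields a closed set that still omits [p]. *)
Lemma class_join_dep p q :
  join_dep (point_J class_system p) (point_J class_system q) -> e p q || e p0 q.
Proof.
case/point_join_depP=> neq_pq [A [clA Ap pqA]].
apply: contraLR pqA; rewrite negb_or => /andP[Npq Np0q].
have clB := class_closedU clA Np0q.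
have /subsetP sB : closure class_system (q |: A) \subset A :|: [set z | e q z].
  by rewrite closure_sub // subUset subsetUl sub1set !inE e_refl orbT.
by apply/negP=> /sB; rewrite !inE (negPf Ap) e_sym (negPf Npq).
Qed.

Lemma class_join_dep_le p q :
  join_dep_le (point_J class_system p) (point_J class_system q) ->
  e p q || e p0 q.
Proof.
have [g pointK gK] := point_J_bij class_system.
case/connectP=> s; elim: s p => [|x s IHs] p /=.
  by move=> _ /(bij_inj (point_J_bij _)) ->; rewrite e_refl.
rewrite -[x]gK => /andP[/class_join_dep px path_s] last_s.
case/orP: (IHs _ path_s last_s) => [xq|->]; last by rewrite orbT.
by case/orP: px => /e_left ->; rewrite xq ?orbT.
Qed.

Hypothesis class_neq2 : #|[set x | e p0 x]| <> 2.

(** If [p] and [q] were the only possible members of the class of [p0], this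
    class would be {[p], [q]}, since these two are equivalent. *)
Lemma exists_third p q : p != q -> e p q ->
  exists x, [/\ e p0 x, x != p & x != q].
Proof.
move=> neq_pq pq.
case: (pickP (fun x => [&& e p0 x, x != p & x != q])) => [x /and3P[]|none].
  by exists x.
have sub x : e p0 x -> (x == p) || (x == q).
  by move=> p0x; have := none x; rewrite p0x -negb_or => /negbFE.
case: class_neq2.
have p0p : e p0 p.
  by case/orP: (sub p0 (e_refl p0)) => /eqP ->; rewrite ?e_refl // e_sym.
suff -> : [set x | e p0 x] = [set p; q] by rewrite cards2 neq_pq.
apply/setP=> x; rewrite !inE; apply/idP/idP => [/sub //|].
by case/orP=> /eqP -> //; rewrite (e_left p0p).
Qed.

(** The closure of [q] and a third point [x] of the class of [p0] contains the
    class of [q]. *)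
Lemma class_join_dep_direct p q : p != q -> e p q ->
  join_dep (point_J class_system p) (point_J class_system q).
Proof.
move=> neq_pq pq; have [x [p0x neq_xp neq_xq]] := exists_third neq_pq pq.
apply/point_join_depP; split=> //; exists [set x]; split.
- exact: class_closed1.
- by rewrite inE eq_sym.
have /class_closedP cl := closure_closed class_system (q |: [set x]).
have /subsetP sub : q |: [set x] \subset closure class_system (q |: [set x]).
  by rewrite -(closure_sub _ (closure_closed _ _)).
by apply: (cl x q) => //; rewrite ?sub ?inE ?eqxx ?orbT // e_sym.
Qed.

Lemma class_lattice_iso :
  rel_iso e (@join_dep_equiv _ (closed_set class_system)).
Proof.
exists (point_J class_system); first exact: point_J_bij.
have reach p q : e p q ->
    join_dep_le (point_J class_system p) (point_J class_system q).
  have [->|neq_pq] := eqVneq p q => pq; first exact: connect0.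
  exact/connect1/class_join_dep_direct.
move=> p q; apply/idP/andP=> [pq|[]].
  by split; apply: reach; rewrite // e_sym.
move=> /class_join_dep_le/orP[//|p0q] /class_join_dep_le/orP[|p0p].
  by rewrite e_sym.
by rewrite -(e_left p0p).
Qed.

End ClassLattice.

Theorem theorem4p1 (P : finType) (asymp : rel P)
  (P_nonempty : 0 < #|P|) (asymp_equiv : equivalence_rel asymp) :
  [<-> (exists (d : Order.disp_t) (L : finTBLatticeType d),
          atomistic L /\ rel_iso asymp (@join_dep_equiv d L));
       (exists (d : Order.disp_t) (L : finTBLatticeType d),
          rel_iso asymp (@join_dep_equiv d L));
       (exists p : P, #|[set x | asymp p x]| <> 2)].
Proof.
tfae.
- by case=> d [L [_ iso]]; exists d, L.
- case=> d [L [f f_bij fE]].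
  have /card_gt0P[p1 _] := P_nonempty.
  have [p class_p] := join_dep_equiv_class_neq2 (f p1).
  have [g fK gK] := f_bij; exists (g p).
  have f_inj := bij_inj f_bij; rewrite -(card_imset _ f_inj).
  suff -> : f @: [set x | asymp (g p) x] = [set q | join_dep_equiv p q] by [].
  by apply/setP=> q; rewrite -[q]gK mem_imset // !inE fE !gK.
case=> p0 class_neq2.
exists _, (closed_set (class_system asymp p0)); split.
  exact: closed_set_atomistic.
exact: class_lattice_iso.
Qed.
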